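(* For $n\ge 0$ and $0\le k\le\lfloor n/2\rfloor$ define $$e_{n-k,k}=\begin{cases}\sum_{i=2}^{n-1}\mathrm{Bell}_{\ge 2}(i) & k=1,\\[2pt] \sum_{i=k}^{n-k}\mathrm{Bell}_{\ge 2}(i) & k=0\text{ or }k>1.\end{cases}$$ Then $$\sum_{\pi\in\mathcal{PS}et(n)}\mathbf{q}^{\mathrm{Desing}(\pi)}=\sum_{k=0}^{\lfloor n/2\rfloor}e_{n-k,k}\left(\sum_{T\in\mathrm{SYT}(n-k,k)}\mathbf{q}^{\mathrm{Des}(T)}\right),$$ and consequently $$\sum_{\pi\in\mathcal{PS}et(n)}\mathcal{F}_{n,\mathrm{Desing}(\pi)}=\sum_{k=0}^{\lfloor n/2\rfloor}e_{n-k,k}\,s_{(n-k,k)} .$$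
   Context: $[n]=\{1,\dots,n\}$. $\mathcal{PS}et(n)$ is the set of all set partitions of $[n]$. For $\pi\in\mathcal{PS}et(n)$, $\mathrm{Sing}(\pi)$ is the set of elements $i$ such that $\{i\}$ is a block of $\pi$, and $\mathrm{Desing}(\pi)=\{i\in[n-1] : i\in\mathrm{Sing}(\pi),\ i+1\notin\mathrm{Sing}(\pi)\}$. $\mathrm{Bell}_{\ge2}(m)$ (associated Bell number) is the number of set partitions of $[m]$ with no singleton blocks; the sequence for $m=0,1,2,\dots$ begins $1,0,1,1,4,11,41,162,\dots$. $\mathrm{SYT}(n-k,k)$ is the set of standard Young tableaux of shape $(n-k,k)$ (one-row shape $(n)$ if $k=0$), drawn in English notation, and $\mathrm{Des}(T)=\{i : i+1 \text{ is in a lower row of } T \text{ than } i\}$. For $A\subseteq[n-1]$, $\mathbf{q}^A=\prod_{i\in A}q_i$, where $q_1,\dots,q_{n-1}$ are commuting variables. For $D\subseteq[n-1]$, $\mathcal{F}_{n,D}=\sum x_{i_1}\cdots x_{i_n}$, summed over $i_1\le\dots\le i_n$ with $i_j<i_{j+1}$ whenever $j\in D$ (fundamental quasi-symmetric function). $s_\lambda$ is the Schur function. *)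

(* Defs.v *)
From HB Require Import structures.
From mathcomp Require Import all_boot all_order all_algebra.
From mathcomp Require Import finmap multiset mpoly.
From mathcomp Require Import functions.

Set Implicit Arguments.
Unset Strict Implicit.
Unset Printing Implicit Defensive.

Import GRing.Theory.

Local Open Scope nat_scope.

(* [n] is 'I_n (the label i is the ordinal i - 1) and [n-1] is 'I_n.-1, with
   ord_here j and ord_next j the elements j and j + 1 of [n]. *)
Definition ord_here n (j : 'I_n.-1) : 'I_n := widen_ord (leq_pred n) j.

Fact ord_next_subproof n (j : 'I_n.-1) : j.+1 < n.
Proof. by rewrite -ltn_predRL. Qed.

Definition ord_next n (j : 'I_n.-1) : 'I_n := Ordinal (ord_next_subproof j).

Definition PSet n : {set {set {set 'I_n}}} :=
  [set P | partition P [set: 'I_n]].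

Definition Sing n (P : {set {set 'I_n}}) : {set 'I_n} :=
  [set i | [set i] \in P].

Definition Desing n (P : {set {set 'I_n}}) : {set 'I_n.-1} :=
  [set j | (ord_here j \in Sing P) && (ord_next j \notin Sing P)].

Definition assoc_bell m : nat := #|[set P in PSet m | Sing P == set0]|.

Definition e_coef n k : nat :=
  if k == 1 then \sum_(2 <= i < n) assoc_bell i
  else \sum_(k <= i < (n - k).+1) assoc_bell i.

(* Shapes are lists of row lengths, from top to bottom; trailing zeros add no
   cell. A cell is a row index together with a column index in that row. *)
Definition cell (sh : seq nat) : finType :=
  {r : 'I_(size sh) & 'I_(nth 0 sh r)}.

Definition cell_row sh (c : cell sh) : nat := tag c.
Definition cell_col sh (c : cell sh) : nat := tagged c.

Definition rows_sorted (r : rel nat) sh (T : cell sh -> nat) : bool :=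
  [forall c, forall d,
    (cell_row c == cell_row d) && (cell_col c < cell_col d) ==> r (T c) (T d)].

Definition cols_sorted (r : rel nat) sh (T : cell sh -> nat) : bool :=
  [forall c, forall d,
    (cell_col c == cell_col d) && (cell_row c < cell_row d) ==> r (T c) (T d)].

Definition semistandard sh (T : cell sh -> nat) : bool :=
  rows_sorted leq T && cols_sorted ltn T.

Definition SYT n sh : {set {ffun cell sh -> 'I_n}} :=
  [set T : {ffun cell sh -> 'I_n} |
    [&& injectiveb T, [forall i, i \in codom T],
        rows_sorted ltn (fun c => T c : nat)
      & cols_sorted ltn (fun c => T c : nat)]].

Definition Des n sh (T : {ffun cell sh -> 'I_n}) : {set 'I_n.-1} :=
  [set j | [exists c, exists d,
    [&& T c == ord_here j, T d == ord_next j & cell_row c < cell_row d]]].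

Definition two_row n k : seq nat := [:: n - k; k].

Definition qmon n (A : {set 'I_n.-1}) : {mpoly int[n.-1]} :=
  (\prod_(j in A) 'X_j)%R.

(* Formal power series over int in countably many variables x_0, x_1, ...:
   a monomial is the multiset of the indices of its variables, and a series
   maps each monomial to its coefficient. *)
Notation series := ({mset nat}%mset -> int).

(* The sum of the monomials \prod_(i : I) x_(w i) over all w : I -> nat with
   P w. Every w with monomial m takes its values in finsupp m, so that the
   coefficient of m counts the functions from I to the finite set finsupp m. *)
Definition sum_monomials (I : finType) (P : pred (I -> nat)) : series :=
  fun m => (#|[set w : {ffun I -> finsupp m} |
    P (fun i => val (w i)) &&
    (seq_mset [seq val (w i) | i : I] == m)]|%:R)%R.

Definition fundamental n (D : {set 'I_n.-1}) : series :=
  sum_monomials (fun w : 'I_n -> nat =>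
    [forall j : 'I_n.-1, w (ord_here j) <= w (ord_next j)] &&
    [forall j in D, w (ord_here j) < w (ord_next j)]).

Definition schur (sh : seq nat) : series := sum_monomials (@semistandard sh).

(* Main.v *)
Require Import Defs.
From mathcomp Require Import all_boot all_order all_algebra.
From mathcomp Require Import finmap multiset mpoly.
From mathcomp Require Import functions boolp.
From mathcomp Require Import zify ring.

(** Choosing the set S of singletons of a partition leaves a partition of the
    complement of S without singletons, so the left-hand side is the sum over m
    of Bell_{>=2}(m) A(n, m), where A(n, m) sums, over the binary words of length
    n with m ones (the ones marking the non-singletons), the product of q_j over
    the positions j of the factors 01.  Let B(n, m) be the same sum restricted to
    ballot words (no prefix has more ones than zeros).  Both A and B satisfy
      X(n+2, m+1) = X(n+1, m+1) + X(n+1, m) + (q_{n+1} - 1) X(n, m),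
    for B only when 2(m+1) <= n+2.  Hence A(n, m) = A(n, n-m), and
    A(n, m) - A(n, m-1) = B(n, m) for 2m <= n, so that A(n, m) is the sum of the
    B(n, k) over k <= min(m, n-m).  Recording the entries of the second row
    identifies B(n, k) with the sum over SYT(n-k, k).

    For the symmetric functions, the coefficient of F_{n,D} at the monomial with
    sorted word w_1 <= ... <= w_n is the product over j in D of [w_j < w_{j+1}],
    and by standardization the coefficient of a Schur function is the sum of
    these products over D = Des(T).  The second identity is therefore the first
    one evaluated at q_j = [w_j < w_{j+1}], coefficient by coefficient. *)

Set Implicit Arguments.
Unset Strict Implicit.
Unset Printing Implicit Defensive.

Import GRing.Theory.

Local Open Scope ring_scope.

(** * Binary words weighted by their ascents *)

(** A prefix of length i has no more ones than zeros exactly when twice its number of ones is at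
    most i. *)
Definition ballot (w : seq bool) : bool :=
  all (fun i => (count id (take i w)).*2 <= i)%N (iota 0 (size w).+1).

Lemma ballot_rcons w b :
  ballot (rcons w b) = ballot w && ((count id (rcons w b)).*2 <= (size w).+1)%N.
Proof.
rewrite /ballot size_rcons -[in LHS]addn1 iotaD all_cat all_seq1 add0n.
rewrite [take _.+1 _]take_oversize ?size_rcons //; congr (_ && _).
apply: eq_in_all => i; rewrite mem_iota /= add0n ltnS => le_iw.
by rewrite -cats1 takel_cat.
Qed.

Lemma ballot_count w : ballot w -> ((count id w).*2 <= size w)%N.
Proof. by move/allP/(_ (size w)); rewrite mem_iota ltnSn take_size; apply. Qed.

Lemma sum_tuple_rcons (V : nmodType) n (F : seq bool -> V) :
  \sum_(t : n.+1.-tuple bool) F t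
  = \sum_(t : n.-tuple bool) F (rcons t true)
    + \sum_(t : n.-tuple bool) F (rcons t false).
Proof.
pose h (p : n.-tuple bool * bool) := [tuple of rcons p.1 p.2].
have h_inj : injective h.
  case=> [t b] [t' b'] /(congr1 val) /= /rcons_inj[/val_inj-> ->] //.
have h_bij : bijective h.
  by apply: inj_card_bij => //; rewrite card_prod !card_tuple card_bool expnSr.
rewrite (reindex h) /=; last exact: onW_bij.
rewrite -(pair_big xpredT xpredT (fun (t : n.-tuple bool) b => F (rcons t b))) /=.
by rewrite -big_split; apply: eq_bigr => t _; rewrite big_bool.
Qed.

Section WordSums.

Variables (R : comNzRingType) (q : nat -> R).

Definition ascent_weight (w : seq bool) : R :=
  \prod_(j < (size w).-1 | ~~ nth false w j && nth false w j.+1) q j.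

Lemma ascent_weight_rcons w b c :
  ascent_weight (rcons (rcons w b) c)
  = (if ~~ b && c then q (size w) else 1) * ascent_weight (rcons w b).
Proof.
rewrite /ascent_weight !size_rcons /= big_mkcond big_ord_recr /= mulrC.
rewrite !nth_rcons !size_rcons !ltnn !eqxx ltnSn; congr (_ * _).
rewrite [RHS]big_mkcond /=; apply: eq_bigr => i _.
have lt_iw := ltn_ord i.
by rewrite (nth_rcons _ (rcons w b)) (nth_rcons _ (rcons w b)) size_rcons ltnS
  (ltnW lt_iw) ltnS lt_iw.
Qed.

(** The predicate [predT] gives A(n, m), and [ballot] gives B(n, m). *)
Definition word_sum (p : pred (seq bool)) n m : R :=
  \sum_(t : n.-tuple bool | p t && (count id t == m)) ascent_weight t.

(* Peel off the last letter: appending 1 changes the weight only when the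
   previous letter is 0, which is where the term (q n - 1) X(n, m) comes from. *)
Lemma word_sum_rec (p : pred (seq bool)) n m :
    (forall w b, size w = n.+1 -> count id (rcons w b) = m.+1 ->
       p (rcons w b) = p w) ->
    (forall w, size w = n -> count id w = m -> p (rcons w false) = p w) ->
  word_sum p n.+2 m.+1
  = word_sum p n.+1 m.+1 + word_sum p n.+1 m + (q n - 1) * word_sum p n m.
Proof.
move=> p_up p_up0; have count_rcons (w : seq bool) b :
  count id (rcons w b) = (count id w + b)%N by rewrite -cats1 count_cat /= addn0.
rewrite {1}/word_sum big_mkcond.
rewrite (sum_tuple_rcons _ (fun w => if p w && (count id w == m.+1)
                                   then ascent_weight w else 0)).
(* Words ending in 0: dropping this letter changes neither the weight nor the number of ones. *)
rewrite addrC -addrA; congr (_ + _).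
  rewrite /word_sum [RHS]big_mkcond; apply: eq_bigr => t _.
  rewrite !count_rcons addn0; case: eqP => [ct|_]; rewrite ?andbF // !andbT.
  rewrite p_up ?size_tuple ?count_rcons ?addn0 ?ct //.
  case: ifP => // _; case/lastP: (tval t) (size_tuple t) => // w b _.
  by rewrite ascent_weight_rcons andbF mul1r.
(* Words ending in 1 are split by their previous letter, and so are the words counted by X(n+1, m)
   on the right. *)
rewrite (sum_tuple_rcons _ (fun w => if p (rcons w true)
      && (count id (rcons w true) == m.+1)
      then ascent_weight (rcons w true) else 0)).
rewrite /word_sum [in RHS]big_mkcond.
rewrite (sum_tuple_rcons _ (fun w => if p w && (count id w == m)
                                   then ascent_weight w else 0)).
rewrite -addrA; congr (_ + _).
  apply: eq_bigr => t _; rewrite !count_rcons !addn1 eqSS.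
  case: eqP => [ct|_]; rewrite ?andbF // !andbT.
  rewrite p_up ?size_rcons ?size_tuple ?count_rcons ?addn1 ?ct //.
  by rewrite ascent_weight_rcons mul1r.
(* Words ending in 01 weigh [q n] times the rest: one copy comes from the words of X(n+1, m) ending
   in 0, the other [q n - 1] from X(n, m). *)
rewrite (big_mkcond (fun t : n.-tuple bool => p t && _)) big_distrr -big_split /=.
apply: eq_bigr => t _; rewrite !count_rcons !addn1 eqSS addn0.
case: eqP => [ct|_]; rewrite ?andbF ?mulr0 ?addr0 // !andbT.
rewrite p_up ?size_rcons ?size_tuple ?count_rcons ?addn1 ?addn0 ?ct //.
rewrite p_up0 ?size_tuple //; case: ifP => _; last by rewrite mulr0 addr0.
rewrite ascent_weight_rcons /= size_tuple.
have -> : ascent_weight (rcons t false) = ascent_weight t.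
  case/lastP: (tval t) => [|w b]; last by rewrite ascent_weight_rcons andbF mul1r.
  by rewrite /ascent_weight !big_ord0.
by rewrite mulrBl mul1r addrC subrK.
Qed.

Lemma ascent_weight_nseq n b : ascent_weight (nseq n b) = 1.
Proof.
rewrite /ascent_weight big1 // => i; rewrite !nth_nseq; have := ltn_ord i.
rewrite [X in (_ < X.-1)%N]size_nseq ltn_predRL => lt_in.
by rewrite lt_in (ltnW lt_in) andNb.
Qed.

(** A constant word has no ascent and is the only word with its length and number of ones. This
    gives the boundary values of the recurrences. *)
Lemma word_sum_const (p : pred (seq bool)) n b : p (nseq n b) ->
  word_sum p n (if b then n else 0) = 1.
Proof.
move=> p_cst; rewrite /word_sum (big_pred1 [tuple of nseq n b]) /=.
  exact: ascent_weight_nseq.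
move=> t; have -> : (count id t == (if b then n else 0)) = (t == [tuple of nseq n b]).
  have -> : (count id t == (if b then n else 0)) = all (pred1 b) t.
    case: b {p_cst}; last first.
      by rewrite -leqn0 leqNgt -has_count -all_predC; apply: eq_all; case.
    by rewrite -[X in _ == X](size_tuple t) -all_count; apply: eq_all; case.
  by rewrite -val_eqE /= -[X in nseq X](size_tuple t); apply/all_pred1P/eqP.
by case: eqP => [->|/eqP/negbTE ne_t]; rewrite /= ?p_cst ?eqxx ?andbF ?ne_t.
Qed.

Lemma word_sum_all_rec n m :
  word_sum predT n.+2 m.+1
  = word_sum predT n.+1 m.+1 + word_sum predT n.+1 m
    + (q n - 1) * word_sum predT n m.
Proof. exact: word_sum_rec. Qed.

(** Appending a letter only adds the ballot test on the whole word, and the bound on [m] makes that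
    test succeed. *)
Lemma word_sum_ballot_rec n m : (m.+1.*2 <= n.+2)%N ->
  word_sum ballot n.+2 m.+1
  = word_sum ballot n.+1 m.+1 + word_sum ballot n.+1 m
    + (q n - 1) * word_sum ballot n m.
Proof.
move=> le_m; apply: word_sum_rec => [w b sz ct|w sz ct].
  by rewrite ballot_rcons sz ct le_m andbT.
by rewrite ballot_rcons sz -cats1 count_cat ct /= addn0 andbC; case: leqP => //; lia.
Qed.

Lemma word_sum_ballot_eq0 n m : (n < m.*2)%N -> word_sum ballot n m = 0.
Proof.
move=> lt_nm; rewrite /word_sum big_pred0 // => t.
apply/negbTE/negP => /andP[/ballot_count]; rewrite size_tuple => le /eqP ct.
by rewrite ct leqNgt lt_nm in le.
Qed.

Lemma word_sum_ballot0 n : word_sum ballot n 0 = 1.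
Proof.
apply: (@word_sum_const ballot n false); apply/allP => i _.
suff -> : count id (take i (nseq n false)) = 0%N by [].
by elim: n i => [|n IHn] [|i] //=; rewrite IHn.
Qed.

Lemma word_sum_all0 n : word_sum predT n 0 = 1.
Proof. exact: (@word_sum_const predT n false). Qed.

Lemma word_sum_alln n : word_sum predT n n = 1.
Proof. exact: (@word_sum_const predT n true). Qed.

(** The recurrence is invariant under m -> n - m, which swaps its first two terms. Reversing and
    complementing words would instead move the positions of the ascents. *)
Lemma word_sum_all_sym n m : (m <= n)%N ->
  word_sum predT n (n - m)%N = word_sum predT n m.
Proof.
elim/ltn_ind: n m => -[|[|n]] IHn m le_mn.
- by case: m le_mn.
- by case: m le_mn => [|[|m]] // _; rewrite word_sum_all0 word_sum_alln.
case: m le_mn => [|m] le_mn; first by rewrite subn0 word_sum_all0 word_sum_alln.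
rewrite subSS; have [->|ne_mn] := eqVneq m n.+1.
  by rewrite subnn word_sum_all0 word_sum_alln.
have le_m : (m <= n)%N by lia.
rewrite subSn // !word_sum_all_rec -(IHn n.+1 _ m) // ?(leqW le_m) //.
rewrite -(IHn n.+1 _ m.+1) // -(IHn n _ m) // subSS -subSn //.
by rewrite [in RHS](addrC (word_sum _ _ (n - m)%N)).
Qed.

(** All terms obey the same recurrence, so the relation propagates by induction on [n]. *)
Lemma word_sum_all_step n m : (m.+1.*2 <= n)%N ->
  word_sum predT n m.+1 = word_sum predT n m + word_sum ballot n m.+1.
Proof.
elim/ltn_ind: n m => -[|[|n]] IHn m le_mn; rewrite ?doubleS // in le_mn *.
have step1 : word_sum predT n.+1 m.+1
             = word_sum predT n.+1 m + word_sum ballot n.+1 m.+1.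
  have [le_m|lt_m] := leqP m.+1.*2 n.+1; first exact: IHn.
  (* Here n + 2 = 2(m + 1): no ballot word of length n + 1 has m + 1 ones, and m, m + 1 are
     exchanged by the symmetry. *)
  rewrite (word_sum_ballot_eq0 lt_m) addr0 -word_sum_all_sym; last by lia.
  by congr word_sum; lia.
rewrite word_sum_all_rec word_sum_ballot_rec // step1.
case: m le_mn {step1} => [|m] le_mn.
  by rewrite !word_sum_all0 !word_sum_ballot0; ring.
by rewrite word_sum_all_rec !(IHn n.+1) ?(IHn n) //; [ring | lia ..].
Qed.

(** The differences of [word_sum_all_step] telescope when 2m <= n; the symmetry covers the other
    half. *)
Lemma word_sum_all_decomp n m : (m <= n)%N ->
  word_sum predT n m = \sum_(0 <= k < (minn m (n - m)%N).+1) word_sum ballot n k.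
Proof.
wlog le_m : m / (m.*2 <= n)%N => [hw|] le_mn.
  have [le_m|lt_m] := leqP m.*2 n; first exact: hw.
  by rewrite -word_sum_all_sym // hw ?subKn ?leq_subr 1?minnC //; lia.
rewrite (minn_idPl _); last by lia.
elim: m le_m {le_mn} => [|m IHm] le_m.
  by rewrite big_nat1 word_sum_all0 word_sum_ballot0.
by rewrite word_sum_all_step // big_nat_recr // IHm //; lia.
Qed.

End WordSums.

(** * Partitions with prescribed singletons *)

(** This is [Sing] over any finite type, so that partitions can be transported along injections. *)
Definition singletons (T : finType) (P : {set {set T}}) : {set T} :=
  [set x | [set x] \in P].

Definition parts (T : finType) (D S : {set T}) : {set {set {set T}}} :=
  [set P | partition P D & singletons P == S].

Lemma set1_inj_eq (T : finType) (x y : T) : ([set x] == [set y]) = (x == y).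
Proof. exact: (inj_eq set1_inj). Qed.

(** Inserting the block {x} is a bijection, undone by deleting that block. *)
Lemma card_partsD1 (T : finType) (D S : {set T}) x : x \in S -> x \in D ->
  #|parts D S| = #|parts (D :\ x) (S :\ x)|.
Proof.
move=> xS xD.
have x_notin Q : Q \in parts (D :\ x) (S :\ x) -> [set x] \notin Q.
  rewrite inE => /andP[_ /eqP/setP/(_ x)].
  by rewrite !inE eqxx /= => ->.
suff -> : parts D S = [set [set x] |: Q | Q in parts (D :\ x) (S :\ x)].
  apply: card_in_imset => Q Q' /x_notin xQ /x_notin xQ' eqQ.
  by rewrite -(setU1K xQ) eqQ setU1K.
apply/setP=> P; apply/idP/imsetP => [|[Q /[dup] /x_notin xQ + ->]].
  rewrite inE => /andP[partP /eqP singP].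
  have xP : [set x] \in P by move: xS; rewrite -singP inE.
  exists (P :\ [set x]); last by rewrite setD1K.
  rewrite inE partitionD1 //= -singP; apply/eqP/setP=> y.
  by rewrite !inE set1_inj_eq.
rewrite !inE => /andP[partQ /eqP singQ]; apply/andP; split.
  rewrite -[D](setD1K xD); apply: partitionU1 => //.
    by apply/set0Pn; exists x; rewrite inE.
  by rewrite disjoints1 !inE eqxx.
apply/eqP/setP=> y; move/setP/(_ y): singQ; rewrite !inE set1_inj_eq => ->.
by case: eqP => // ->.
Qed.

Lemma card_parts_setD (T : finType) (D S : {set T}) : S \subset D ->
  #|parts D S| = #|parts (D :\: S) set0|.
Proof.
have [m] := ubnP #|S|; elim: m D S => // m IHm D S ltSm sSD.
have [->|[x xS]] := set_0Vmem S; first by rewrite setD0.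
have xD := subsetP sSD x xS; rewrite (card_partsD1 xS xD) IHm.
- by rewrite setDDl setD1K.
- by move: ltSm; rewrite (cardsD1 x) xS.
- exact: setSD.
Qed.

Lemma card_parts_imset (T T' : finType) (f : T -> T') (D : {set T}) :
  injective f -> #|parts (f @: D) set0| = #|parts D set0|.
Proof.
move=> f_inj; have imf_inj := imset_inj f_inj.
suff -> : parts (f @: D) set0
          = [set [set f @: (B : {set T}) | B in (P : {set {set T}})] | P in parts D set0].
  by apply: card_imset; apply: imset_inj imf_inj.
have sing_im (P : {set {set T}}) :
    singletons [set f @: (B : {set T}) | B in P] = f @: singletons P.
  apply/setP=> y; rewrite inE; apply/imsetP/imsetP => [[B BP eqB]|[x + ->]].
    have /imsetP[x xB yfx] : y \in f @: B by rewrite -eqB inE.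
    exists x; rewrite // inE; suff <- : B = [set x] by [].
    by apply: imf_inj; rewrite /= -eqB imset_set1 yfx.
  by rewrite inE => xP; exists [set x]; rewrite // imset_set1.
apply/setP=> Q; apply/idP/imsetP => [|[P + ->]]; last first.
  rewrite !inE imset_partition // => /andP[-> /eqP singP] /=.
  by rewrite sing_im singP imset0.
rewrite inE => /andP[partQ /eqP singQ].
(* Blocks of [Q] lie in the image of [f], so each one is the image of its preimage. *)
pose P := [set f @^-1: (B : {set T'}) | B in Q].
have QE : Q = [set f @: (B : {set T}) | B in P].
  rewrite -imset_comp -[LHS]imset_id; apply: eq_in_imset => B BQ /=.
  apply/setP=> y; apply/idP/imsetP => [yB|[x]]; last by rewrite inE => ? ->.
  have /imsetP[x _ yfx] := subsetP (partitionS partQ BQ) y yB.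
  by exists x; rewrite // inE -yfx.
exists P => //; rewrite inE -(imset_partition _ _ f_inj) -QE partQ /=.
by move: singQ; rewrite QE sing_im => /eqP; rewrite imset_eq0.
Qed.

(** Deleting the singletons leaves a singleton-free partition of [A], and [enum_val] relabels [A] by
    its size. *)
Lemma card_Sing n (A : {set 'I_n}) :
  #|[set P in PSet n | Sing P == ~: A]| = assoc_bell #|A|.
Proof.
transitivity #|parts [set: 'I_n] (~: A)|.
  by apply: eq_card => P; rewrite !inE.
rewrite card_parts_setD ?subsetT // setTD setCK.
have -> : A = enum_val @: [set: 'I_#|A|].
  apply/setP=> x; apply/idP/imsetP => [xA|[i _ ->]]; last exact: enum_valP.
  by exists (enum_rank_in xA x); rewrite // enum_rankK_in.
rewrite card_parts_imset; last exact: enum_val_inj.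
rewrite card_imset ?cardsT ?card_ord; last exact: enum_val_inj.
by apply: eq_card => P; rewrite !inE.
Qed.

(** * Subsets as binary words *)

Definition char_tuple n (A : {set 'I_n}) : n.-tuple bool := [tuple i \in A | i < n].

Lemma char_tuple_bij n : bijective (@char_tuple n).
Proof.
exists (fun t => [set i | tnth t i]) => [A|t].
  by apply/setP=> i; rewrite inE tnth_mktuple.
by apply: eq_from_tnth => i; rewrite tnth_mktuple inE.
Qed.

Lemma nth_char_tuple n (A : {set 'I_n}) (i : 'I_n) b :
  nth b (char_tuple A) i = (i \in A).
Proof. exact: nth_mktuple. Qed.

Lemma count_char_tuple n (A : {set 'I_n}) : count id (char_tuple A) = #|A|.
Proof.
by rewrite /char_tuple /= count_map cardE size_filter enumT; apply: eq_count.
Qed.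

Lemma ascent_weight_char (R : comNzRingType) (q : nat -> R) n (A : {set 'I_n}) :
  ascent_weight q (char_tuple A)
  = \prod_(j : 'I_n.-1 | (ord_here j \notin A) && (ord_next j \in A)) q j.
Proof.
rewrite /ascent_weight -(big_mkord (fun j => ~~ nth false (char_tuple A) j
  && nth false (char_tuple A) j.+1)) size_tuple big_mkord.
by apply: eq_bigl => j; rewrite -!(nth_char_tuple A _ false).
Qed.

(** Partitions are grouped by the word marking their non-singletons, whose factors 01 sit exactly at
    [Desing P]; words are then grouped by their number of ones. *)
Lemma sum_PSet (R : comNzRingType) (q : nat -> R) n :
  \sum_(P in PSet n) \prod_(j in Desing P) q j
  = \sum_(0 <= m < n.+1) word_sum q predT n m *+ assoc_bell m.
Proof.
rewrite (partition_big (fun P => char_tuple (~: Sing P)) predT) //=.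
rewrite big_mkord; transitivity (\sum_(t : n.-tuple bool)
    ascent_weight q t *+ assoc_bell (count id t)).
  apply: eq_bigr => t _; have [g gK Kg] := char_tuple_bij n.
  rewrite -(Kg t); move: (g t) => A.
  rewrite count_char_tuple -card_Sing -sumr_const.
  apply: eq_big => [P|P /andP[_ /eqP eqA]].
    by rewrite !inE (can_eq gK) -(can_eq (@setCK _)) setCK.
  rewrite -eqA ascent_weight_char; apply: eq_bigl => j.
  by rewrite !inE negbK.
have count_lt (t : n.-tuple bool) : (count id t < n.+1)%N.
  by rewrite ltnS -[X in (_ <= X)%N](size_tuple t) count_size.
rewrite (partition_big (fun t : n.-tuple bool => inord (count id t) : 'I_n.+1) predT) //.
apply: eq_bigr => m _; rewrite -sumrMnl; apply: eq_big => t /=.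
  by rewrite -val_eqE /= inordK.
by move=> /eqP <-; rewrite inordK.
Qed.

(** * Standard tableaux with two rows *)

Local Open Scope nat_scope.

(** The bound is a natural number so that x = n is allowed. For x in [A] this is the position of x
    in [A], counted from 0. *)
Definition rank n (A : {set 'I_n}) (x : nat) : nat := #|[set i in A | i < x]|.

Lemma rank0 n (A : {set 'I_n}) : rank A 0 = 0.
Proof. by apply: eq_card0 => i; rewrite !inE ltn0 andbF. Qed.

Lemma rankS n (A : {set 'I_n}) (i : 'I_n) : rank A i.+1 = (i \in A) + rank A i.
Proof.
rewrite /rank (cardsD1 i) !inE ltnSn andbT; congr (_ + _).
apply: eq_card => j; rewrite !inE ltnS [in RHS]ltn_neqAle -val_eqE /=.
by rewrite andbCA.
Qed.

Lemma rank_setC n (A : {set 'I_n}) x : x <= n -> rank A x + rank (~: A) x = x.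
Proof.
elim: x => [|x IHx] lt_xn; first by rewrite !rank0.
have /= := rankS _ (Ordinal lt_xn); move=> ->; have /= := rankS (~: A) (Ordinal lt_xn).
move=> ->; have := IHx (ltnW lt_xn); rewrite inE; case: (_ \in A) => /=; lia.
Qed.

Lemma rank_le n (A : {set 'I_n}) x y : x <= y -> rank A x <= rank A y.
Proof.
move=> le_xy; apply/subset_leq_card/subsetP=> i; rewrite !inE => /andP[-> lt_ix].
exact: leq_trans lt_ix le_xy.
Qed.

Lemma rank_lt_card n (A : {set 'I_n}) (i : 'I_n) : i \in A -> rank A i < #|A|.
Proof.
move=> iA; rewrite -add1n -[1]/(nat_of_bool true) -iA -rankS.
by apply/subset_leq_card/subsetP=> j; rewrite inE => /andP[].
Qed.

Lemma rank_lt n (A : {set 'I_n}) (i : 'I_n) x : i \in A -> i < x -> rank A i < rank A x.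
Proof. by move=> iA lt_ix; apply: leq_trans (rank_le A lt_ix); rewrite rankS iA. Qed.

Lemma rank_ltW n (A : {set 'I_n}) x y : rank A x < rank A y -> x < y.
Proof. by apply: contraTT; rewrite -!leqNgt; apply: rank_le. Qed.

Lemma rank_inj n (A : {set 'I_n}) : {in A &, injective (fun i : 'I_n => rank A i)}.
Proof.
move=> i j iA jA eq_ij; apply/val_inj; case: (ltngtP i j) => // lt_ij.
  by have := rank_lt iA lt_ij; rewrite eq_ij ltnn.
by have := rank_lt jA lt_ij; rewrite eq_ij ltnn.
Qed.

Lemma rank_imset m n (f : 'I_m -> 'I_n) (x : nat) : injective f ->
  rank (f @: setT) x = #|[set c | f c < x]|.
Proof.
move=> f_inj; rewrite -(card_imset _ f_inj); apply: eq_card => i.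
rewrite !inE; apply/andP/imsetP => [[/imsetP[c _ ->] lt_x]|[c + ->]].
  by exists c; rewrite // inE.
by rewrite inE => lt_x; rewrite imset_f.
Qed.

Lemma increasing_inj m n (f : 'I_m -> 'I_n) : {homo f : c d / c < d} -> injective f.
Proof.
by move=> f_lt c d eq_f; apply/val_inj; case: (ltngtP c d) => // /f_lt; rewrite eq_f ltnn.
Qed.

(** The values of [f] below [f c] are exactly those at the [c] indices before [c]. *)
Lemma rank_increasing m n (f : 'I_m -> 'I_n) (c : 'I_m) :
  {homo f : c d / c < d} -> rank (f @: setT) (f c) = c.
Proof.
move=> f_lt; rewrite rank_imset; last exact: increasing_inj.
rewrite -[RHS](card_ord c) -cardsT.
have w_inj : injective (widen_ord (ltnW (ltn_ord c))).
  by move=> i j /(congr1 val) /= /val_inj.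
rewrite -(card_imset _ w_inj); apply: eq_card => d.
rewrite !inE; apply/idP/imsetP => [lt_f|[e _ ->]].
  2: exact: (f_lt (widen_ord _ e) c (ltn_ord e)).
have lt_dc : d < c.
  by case: (ltngtP d c) lt_f => [//|/f_lt /= lt_f|/val_inj->];
    rewrite ?ltnn // ltnNge ltnW.
by exists (Ordinal lt_dc) => //; apply: val_inj.
Qed.

Lemma increasing_eq m n (f g : 'I_m -> 'I_n) :
  {homo f : c d / c < d} -> {homo g : c d / c < d} ->
  f @: setT = g @: setT -> f =1 g.
Proof.
move=> f_lt g_lt eq_im c; have /imsetP[d _ fgd] : f c \in g @: setT.
  by rewrite -eq_im imset_f.
rewrite fgd; congr g; apply: val_inj.
by rewrite /= -(rank_increasing c f_lt) -(rank_increasing d g_lt) eq_im fgd.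
Qed.

Lemma ballotP n (A : {set 'I_n}) :
  reflect (forall x, x <= n -> rank A x <= rank (~: A) x) (ballot (char_tuple A)).
Proof.
have count_take x : x <= n -> count id (take x (char_tuple A)) = rank A x.
  elim: x => [|x IHx] lt_xn; first by rewrite take0 rank0.
  rewrite (take_nth false) ?size_tuple // -cats1 count_cat IHx 1?ltnW //= addn0.
  by have /= -> := nth_char_tuple A (Ordinal lt_xn) false;
    have /= -> := rankS A (Ordinal lt_xn); rewrite addnC.
apply: (iffP allP) => [bal x le_xn|bal x]; last first.
  rewrite mem_iota size_tuple ltnS => le_xn; rewrite count_take //.
  by have := bal x le_xn; have := rank_setC A le_xn; lia.
have := bal x; rewrite mem_iota size_tuple ltnS count_take // => /(_ le_xn).
by have := rank_setC A le_xn; lia.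
Qed.

(** * Two-row tableaux and the sets of their bottom entries *)

Definition top_cell n k (c : 'I_(n - k)) : cell (two_row n k) :=
  existT (fun r : 'I_2 => 'I_(nth 0 (two_row n k) r)) (Ordinal (isT : 0 < 2)) c.

Definition bottom_cell n k (c : 'I_k) : cell (two_row n k) :=
  existT (fun r : 'I_2 => 'I_(nth 0 (two_row n k) r)) (Ordinal (isT : 1 < 2)) c.

Lemma two_row_cell_ind n k (P : cell (two_row n k) -> Prop) :
  (forall c, P (@top_cell n k c)) -> (forall c, P (@bottom_cell n k c)) ->
  forall c, P c.
Proof.
move=> P0 P1 [[[|[|//]] lt_r] c]; move: c; rewrite (bool_irrelevance lt_r isT) => c.
  exact: P0.
exact: P1.
Qed.

Section TwoRow.

Variables (n k : nat) (le_k : k.*2 <= n).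
Implicit Types T : {ffun cell (two_row n k) -> 'I_n}.

Let top := @top_cell n k.
Let bot := @bottom_cell n k.

Definition bottom_set T : {set 'I_n} := (fun c => T (bot c)) @: setT.

Lemma card_two_row : #|cell (two_row n k)| = n.
Proof.
rewrite card_tagged sumnE big_map big_enum /= !big_ord_recl big_ord0 !card_ord /=.
by rewrite addn0 subnK //; lia.
Qed.

Lemma SYT_two_rowP T : T \in SYT n (two_row n k) ->
  [/\ injective T, (forall i, exists c, i = T c),
      {homo (fun c => T (top c)) : c d / c < d},
      {homo (fun c => T (bot c)) : c d / c < d}
    & forall c d, val c = val d -> T (top c) < T (bot d)].
Proof.
rewrite inE => /and4P[/injectiveP T_inj /forallP T_surj /forallP T_row /forallP T_col].
split=> // [i|c d lt_cd|c d lt_cd|c d eq_cd].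
- by have /codomP[c] := T_surj i; exists c.
- have /forallP/(_ (top d)) := T_row (top c).
  by rewrite /cell_row /cell_col /= lt_cd.
- have /forallP/(_ (bot d)) := T_row (bot c).
  by rewrite /cell_row /cell_col /= lt_cd.
- have /forallP/(_ (bot d)) := T_col (top c).
  by rewrite /cell_row /cell_col /= eq_cd eqxx.
Qed.

Lemma mem_bottom_set T c : injective T -> (T c \in bottom_set T) = (cell_row c == 1).
Proof.
move=> T_inj; apply/imsetP/idP => [[d _ /T_inj ->] //|].
by elim/two_row_cell_ind: c => // c _; exists c.
Qed.

Lemma top_set T : injective T -> (forall i, exists c, i = T c) ->
  ~: bottom_set T = (fun c => T (top c)) @: setT.
Proof.
move=> T_inj T_surj; apply/setP=> i; have [c ->] := T_surj i.
rewrite inE mem_bottom_set //; apply/idP/imsetP => [|[d _ /T_inj ->] //].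
by elim/two_row_cell_ind: c => // c _; exists c.
Qed.

(** The two rows list the bottom set and its complement in increasing order. *)
Lemma bottom_set_inj : {in SYT n (two_row n k) &, injective bottom_set}.
Proof.
move=> T T' /SYT_two_rowP[T_inj T_surj T_top T_bot _].
move=> /SYT_two_rowP[T'_inj T'_surj T'_top T'_bot _] eqb.
apply/ffunP; elim/two_row_cell_ind => c.
  by apply: (increasing_eq T_top T'_top); rewrite -!top_set ?eqb.
exact: (increasing_eq T_bot T'_bot).
Qed.

(** Each bottom entry has a smaller entry above it, so below any bound the top entries are at least
    as many. *)
Lemma ballot_bottom_set T : T \in SYT n (two_row n k) ->
  ballot (char_tuple (bottom_set T)) && (#|bottom_set T| == k).
Proof.
move=> /SYT_two_rowP[T_inj T_surj T_top T_bot T_col].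
rewrite card_imset ?cardsT ?card_ord ?eqxx ?andbT; last exact: increasing_inj.
apply/ballotP => x _; rewrite top_set //.
rewrite !rank_imset; try exact: increasing_inj.
have le_kn : k <= n - k by lia.
have w_inj : injective (widen_ord le_kn) by move=> c d /(congr1 val) /= /val_inj.
rewrite -(card_imset _ w_inj); apply/subset_leq_card/subsetP => _ /imsetP[c + ->].
by rewrite !inE; apply: ltn_trans; apply: T_col.
Qed.

Lemma ballot_bottom_set_surj (A : {set 'I_n}) :
    ballot (char_tuple A) -> #|A| = k ->
  exists2 T, T \in SYT n (two_row n k) & A = bottom_set T.
Proof.
move=> /ballotP A_bal cardA.
have cardAC : #|~: A| = n - k by rewrite cardsCs setCK card_ord cardA.
have rank_top i : i \notin A -> rank (~: A) i < n - k.
  by move=> iA; rewrite -cardAC rank_lt_card // inE.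
have rank_bot (i : 'I_n) : i \in A -> rank A i < k.
  by move=> iA; rewrite -cardA rank_lt_card.
(* [g] puts a label in the row chosen by [A], at the column given by its rank among the labels of
   that row; the tableau is the inverse of [g]. *)
have /fin_all_exists[g g_rc] : forall i, exists c : cell (two_row n k),
    cell_row c = (i \in A) /\ cell_col c = if i \in A then rank A i else rank (~: A) i.
  move=> i; have [iA|iA] := boolP (i \in A).
    by exists (bot (Ordinal (rank_bot i iA))).
  by exists (top (Ordinal (rank_top i iA))).
have g_row i := (g_rc i).1; have g_col i := (g_rc i).2.
have g_inj : injective g.
  move=> i j eq_g; have := g_col i; rewrite eq_g g_col.
  have := g_row i; rewrite eq_g g_row; case jA: (j \in A); case iA: (i \in A) => // _.
    by move=> eq_r; apply: (rank_inj iA jA).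
  by move=> eq_r; apply: (@rank_inj _ (~: A)); rewrite ?inE ?iA ?jA.
have [T gK Tg] : bijective g by apply: inj_card_bij; rewrite // card_two_row card_ord.
have T_inj : injective T := can_inj Tg.
have finT c : [ffun c => T c] c = T c by rewrite ffunE.
exists [ffun c => T c]; last first.
  apply/setP=> i; rewrite -[i]gK -(finT (g i)) mem_bottom_set ?g_row; last first.
    by move=> c d; rewrite !ffunE => /T_inj.
  by rewrite finT gK; case: (_ \in _).
rewrite inE; apply/and4P; split.
- by apply/injectiveP => c d; rewrite !finT => /T_inj.
- by apply/forallP => i; apply/codomP; exists (g i); rewrite finT gK.
- apply/forallP => c; apply/forallP => d; apply/implyP; rewrite !finT.
  rewrite -(Tg c) -(Tg d) !gK; move: (T c) (T d) => i j; rewrite !g_row !g_col.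
  by case: (i \in A); case: (j \in A) => //= /rank_ltW.
apply/forallP => c; apply/forallP => d; apply/implyP; rewrite !finT.
rewrite -(Tg c) -(Tg d) !gK; move: (T c) (T d) => i j; rewrite !g_row !g_col.
case iA: (i \in A); case jA: (j \in A) => //= /andP[/eqP eq_r] // _.
rewrite ltnNge; apply/negP => le_ji.
(* If the bottom label j were at most the top label i of its column, the prefix ending at j would
   have more ones than zeros. *)
have := A_bal j.+1 (ltn_ord j); rewrite !rankS inE jA /= add0n -eq_r.
by have := rank_le (~: A) le_ji; lia.
Qed.

(** A descent at j means that j is in the top row and j + 1 in the bottom row: a factor 01 of the
    word of [bottom_set T]. *)
Lemma sum_SYT_two_row (R : comNzRingType) (q : nat -> R) :
  (\sum_(T in SYT n (two_row n k)) \prod_(j in Des T) q j = word_sum q ballot n k)%R.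
Proof.
rewrite /word_sum (reindex (@char_tuple n)) /=; last exact/onW_bij/char_tuple_bij.
rewrite (eq_bigl (mem [set bottom_set T | T in SYT n (two_row n k)])); last first.
  move=> A; rewrite count_char_tuple; apply/andP/imsetP => [[A_bal /eqP cardA]|].
    by have [T] := ballot_bottom_set_surj A_bal cardA; exists T.
  by case=> T /ballot_bottom_set/andP[? ?] ->.
rewrite big_imset /=; last exact: bottom_set_inj.
apply: eq_bigr => T /SYT_two_rowP[T_inj T_surj _ _ _]; rewrite ascent_weight_char.
apply: eq_bigl => j; rewrite inE.
have row_lt2 (c : cell (two_row n k)) : cell_row c < 2 by case: c => [[r] ] /=.
have [c eq_c] := T_surj (ord_here j); have [d eq_d] := T_surj (ord_next j).
rewrite eq_c eq_d !mem_bottom_set //; apply/existsP/andP => [[c' /existsP[d']]|[c0 d1]].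
  case/and3P=> /eqP/T_inj-> /eqP/T_inj->.
  by have := row_lt2 c; have := row_lt2 d; lia.
exists c; apply/existsP; exists d; rewrite !eqxx /=.
by have := row_lt2 c; have := row_lt2 d; lia.
Qed.

End TwoRow.

(** * The generating function identity *)

Local Open Scope ring_scope.

Lemma assoc_bell1 : assoc_bell 1 = 0%N.
Proof.
apply: eq_card0 => P; rewrite !inE; apply/negP => /andP[partP /eqP/setP/(_ ord0)].
rewrite !inE => /negP; apply.
have /bigcupP[B BP B0] : ord0 \in cover P by rewrite (cover_partition partP) inE.
suff <- : B = [set ord0] by [].
by apply/setP=> i; rewrite ord1 B0 inE eqxx.
Qed.

(** The case k = 1 only omits the term i = 1, which vanishes. *)
Lemma e_coefE n k : (k.*2 <= n)%N ->
  e_coef n k = (\sum_(k <= i < (n - k).+1) assoc_bell i)%N.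
Proof.
rewrite /e_coef; case: eqP => // -> lt1n.
by rewrite subn1 (ltn_predK lt1n) [RHS]big_ltn // assoc_bell1.
Qed.

(** The ring is arbitrary so that [q] can be specialized both to variables and to 0/1 values.
    Exchanging the sums collects, for each k, the m with k <= m <= n - k. *)
Lemma sum_PSet_SYT (R : comNzRingType) (q : nat -> R) n :
  \sum_(P in PSet n) \prod_(j in Desing P) q j
  = \sum_(0 <= k < n./2.+1)
      (\sum_(T in SYT n (two_row n k)) \prod_(j in Des T) q j) *+ e_coef n k.
Proof.
rewrite sum_PSet; transitivity (\sum_(0 <= m < n.+1) \sum_(0 <= k < n./2.+1)
    if (k <= m < (n - k).+1)%N then word_sum q ballot n k *+ assoc_bell m else 0).
  apply: eq_big_nat => m /= le_mn; rewrite word_sum_all_decomp // -sumrMnl.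
  rewrite (big_nat_widen _ (minn m (n - m)%N).+1 n./2.+1) /=; last by lia.
  rewrite [LHS]big_mkcond.
  by apply: eq_big_nat => k _; congr (if _ then _ else _); lia.
rewrite exchange_big_nat; apply: eq_big_nat => k /= le_k.
have le_kn : (k.*2 <= n)%N by lia.
rewrite sum_SYT_two_row // e_coefE // -sumrMnr -big_mkcond /=.
rewrite [RHS](big_nat_widen _ _ n.+1) /=; last by lia.
rewrite [RHS](big_nat_widenl _ 0) //=.
by apply: eq_bigl => m; rewrite andbC.
Qed.

(** * Standardization *)

Local Open Scope nat_scope.

Section Standardization.

Variables (sh : seq nat) (n : nat) (s : seq nat).
Hypotheses (card_sh : #|cell sh| = n) (s_sorted : sorted leq s) (size_s : size s = n).

Implicit Types (c d e : cell sh) (U : cell sh -> nat) (T : {ffun cell sh -> 'I_n}).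

Lemma cell_inj c d : cell_row c = cell_row d -> cell_col c = cell_col d -> c = d.
Proof.
case: c d => [r i] [r' i']; rewrite /cell_row /cell_col /= => /val_inj eq_r.
by case: r' / eq_r i' => i' /val_inj ->.
Qed.

(* The order in which standardization numbers the cells: equal entries are
   numbered from the bottom row up, then left to right, creating no descent. *)
Definition reads_before U c d : bool :=
  (U c < U d) || (U c == U d) &&
  ((cell_row d < cell_row c) || (cell_row c == cell_row d) && (cell_col c < cell_col d)).

Lemma reads_before_irr U c : reads_before U c c = false.
Proof. by rewrite /reads_before !ltnn !eqxx. Qed.

Lemma reads_before_trans U c d e :
  reads_before U c d -> reads_before U d e -> reads_before U c e.
Proof. rewrite /reads_before; lia. Qed.

Lemma reads_before_total U c d : c != d -> reads_before U c d || reads_before U d c.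
Proof.
move=> ne_cd; rewrite /reads_before.
case: (ltngtP (U c) (U d)) => //= _.
case: (ltngtP (cell_row c) (cell_row d)) => //= eq_r.
case: (ltngtP (cell_col c) (cell_col d)) => //= eq_c.
by rewrite (cell_inj eq_r eq_c) eqxx in ne_cd.
Qed.

(** This says that [s] is one of the words summed in the fundamental function of [Des T]. With
    [size s = n], the default 0 is never read. *)
Definition strict_on_descents T : bool :=
  [forall j in Des T, nth 0 s j < nth 0 s j.+1].

Lemma nth_sorted_le i j : i <= j -> j < n -> nth 0 s i <= nth 0 s j.
Proof.
move=> le_ij lt_jn; apply: (sorted_leq_nth leq_trans leqnn) => //;
  by rewrite inE size_s // (leq_ltn_trans le_ij).
Qed.

Lemma SYT_bij T : T \in SYT n sh -> bijective T.
Proof.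
rewrite inE => /and4P[/injectiveP T_inj _ _ _]; apply: inj_card_bij T_inj _.
by rewrite card_ord card_sh.
Qed.

Lemma SYT_row T c d : T \in SYT n sh ->
  cell_row c = cell_row d -> cell_col c < cell_col d -> T c < T d.
Proof.
rewrite inE => /and4P[_ _ /forallP/(_ c)/forallP/(_ d)/implyP T_row _] eq_r lt_c.
by apply: T_row; rewrite eq_r eqxx.
Qed.

Lemma SYT_col T c d : T \in SYT n sh ->
  cell_col c = cell_col d -> cell_row c < cell_row d -> T c < T d.
Proof.
rewrite inE => /and4P[_ _ _ /forallP/(_ c)/forallP/(_ d)/implyP T_col] eq_c lt_r.
by apply: T_col; rewrite eq_c eqxx.
Qed.

(* Labels between T c and T d carry the same letter of s, so none is a descent. *)
Lemma level_rows T c d : T \in SYT n sh -> strict_on_descents T ->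
  T c < T d -> nth 0 s (T c) = nth 0 s (T d) -> cell_row d <= cell_row c.
Proof.
move=> T_syt /forall_inP T_des lt_cd eq_cd; have [g gK Kg] := SYT_bij T_syt.
have [m] := ubnP (T d - T c); elim: m c lt_cd eq_cd => // m IHm c lt_cd eq_cd lt_m.
have lt_c : (T c).+1 < n := leq_ltn_trans lt_cd (ltn_ord (T d)).
pose j : 'I_n.-1 := Ordinal (etrans (ltn_predRL _ _) lt_c).
have Tc : T c = ord_here j by apply: val_inj.
(* [e] carries the next label after [c]; it is not in a lower row, and the induction goes on from it
   to [d]. *)
set e := g (ord_next j); have Te : T e = ord_next j by rewrite Kg.
have eq_ce : nth 0 s (T c) = nth 0 s (T e).
  apply/eqP; rewrite eqn_leq Te /= nth_sorted_le //= eq_cd.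
  by rewrite nth_sorted_le.
have le_ec : cell_row e <= cell_row c.
  rewrite leqNgt; apply/negP => lt_ce; suff /T_des : j \in Des T.
    by move: eq_ce; rewrite Te /= => ->; rewrite ltnn.
  by rewrite inE; apply/existsP; exists c; apply/existsP; exists e; rewrite Tc Te !eqxx.
apply: leq_trans le_ec; have [<-|ne_ed] := eqVneq e d; first exact: leqnn.
have lt_ed : T e < T d.
  rewrite ltn_neqAle Te /= lt_cd andbT; apply: contra ne_ed => /eqP eq_d.
  by apply/eqP/(can_inj gK)/val_inj; rewrite Te.
apply: IHm; rewrite // -?eq_ce //.
have -> : T e = (T c).+1 :> nat by rewrite Te.
lia.
Qed.

(** Larger labels carry larger letters, or equal letters in a higher row or further right in the
    same row. The converse holds because [reads_before] is a strict order. *)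
Lemma SYT_ltE T c d : T \in SYT n sh -> strict_on_descents T ->
  (T c < T d) = reads_before (fun c => nth 0 s (T c)) c d.
Proof.
move=> T_syt T_des; set U : cell sh -> nat := fun c => nth 0 s (T c).
have lt_before e f : T e < T f -> reads_before U e f.
  move=> lt_ef; rewrite /reads_before.
  have := nth_sorted_le (ltnW lt_ef) (ltn_ord _).
  rewrite leq_eqVlt -/(U e) -/(U f) => /orP[/eqP eq_U|-> //].
  have := level_rows T_syt T_des lt_ef eq_U.
  rewrite eq_U eqxx ltnn leq_eqVlt /= => /orP[/eqP eq_r|-> //].
  rewrite eq_r eqxx ltnn /=; case: (ltngtP (cell_col e) (cell_col f)) => // [lt_c|eq_c].
    by have := SYT_row T_syt eq_r lt_c; rewrite ltnNge ltnW.
  by rewrite (cell_inj (esym eq_r) eq_c) ltnn in lt_ef.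
apply/idP/idP => [|bef_cd]; first exact: lt_before.
case: (ltngtP (T c) (T d)) => // [lt_dc|/val_inj/(bij_inj (SYT_bij T_syt)) eq_cd].
  by have := reads_before_trans bef_cd (lt_before _ _ lt_dc); rewrite reads_before_irr.
by rewrite eq_cd reads_before_irr in bef_cd.
Qed.

Lemma SYT_rank T c : T \in SYT n sh -> T c = #|[set d | T d < T c]| :> nat.
Proof.
move=> T_syt; have T_inj := bij_inj (SYT_bij T_syt); have [g gK Kg] := SYT_bij T_syt.
rewrite -[LHS]card_ord -cardsT -(card_imset _ T_inj).
have w_inj : injective (widen_ord (ltnW (ltn_ord (T c)))).
  by move=> i j /(congr1 val) /= /val_inj.
rewrite -(card_imset _ w_inj); apply: eq_card => i.
apply/imsetP/imsetP => [[j _ ->]|[d + ->]].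
  by exists (g (widen_ord (ltnW (ltn_ord (T c))) j)); rewrite ?Kg // inE Kg /=.
by rewrite inE => lt_d; exists (Ordinal lt_d) => //; apply: val_inj.
Qed.

(** A label is the number of smaller labels, and by [SYT_ltE] the filling determines which labels
    are smaller. *)
Lemma standardization_inj T T' :
    T \in SYT n sh -> strict_on_descents T ->
    T' \in SYT n sh -> strict_on_descents T' ->
  (forall c, nth 0 s (T c) = nth 0 s (T' c)) -> T = T'.
Proof.
move=> T_syt T_des T'_syt T'_des eq_U; apply/ffunP=> c; apply: val_inj.
rewrite /= (SYT_rank c T_syt) (SYT_rank c T'_syt); apply: eq_card => d.
by rewrite !inE (SYT_ltE _ _ T_syt) // (SYT_ltE _ _ T'_syt) // /reads_before !eq_U.
Qed.

Lemma SYT_semistandard T : T \in SYT n sh -> strict_on_descents T ->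
  semistandard (fun c => nth 0 s (T c)).
Proof.
move=> T_syt T_des; apply/andP; split; apply/forallP=> c; apply/forallP=> d;
  apply/implyP => /andP[/eqP eq_rc lt_rc].
  exact/nth_sorted_le/ltn_ord/ltnW/SYT_row.
(* A cell is read before a lower one only if its entry is strictly smaller. *)
have := SYT_col T_syt eq_rc lt_rc; rewrite SYT_ltE // /reads_before.
by rewrite (ltnNge (cell_row d)) (ltnW lt_rc) (ltn_eqF lt_rc) /= andbF orbF.
Qed.

Lemma SYT_content T : T \in SYT n sh -> perm_eq [seq nth 0 s (T c) | c : cell sh] s.
Proof.
move=> T_syt; have T_inj := bij_inj (SYT_bij T_syt).
have -> : [seq nth 0 s (T c) | c : cell sh]
          = map (nth 0 s \o val) (map T (enum (cell sh))).
  by rewrite -map_comp.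
have s_map : s = map (nth 0 s \o val) (enum 'I_n).
  rewrite map_comp val_enum_ord; apply: (@eq_from_nth _ 0) => [|i lt_i].
    by rewrite size_map size_iota size_s.
  by rewrite (nth_map 0) ?size_iota -?size_s // nth_iota.
rewrite [X in perm_eq _ X]s_map.
apply: perm_map; apply: uniq_perm; rewrite ?enum_uniq //.
  by rewrite map_inj_uniq ?enum_uniq.
have [g gK Kg] := SYT_bij T_syt; move=> i; rewrite mem_enum; apply/mapP.
by exists (g i); rewrite ?mem_enum ?Kg.
Qed.

Lemma standardization_exists U :
    semistandard U -> perm_eq [seq U c | c : cell sh] s ->
  exists2 T, (T \in SYT n sh) && strict_on_descents T
           & forall c, U c = nth 0 s (T c).
Proof.
move=> /andP[/forallP U_row /forallP U_col] U_s.
(* The label of a cell is its position in the linear order [reads_before U]. *)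
pose pos c := #|[set d | reads_before U d c]|.
have pos_lt c d : reads_before U c d -> pos c < pos d.
  move=> bef_cd; apply/proper_card/properP; split.
    by apply/subsetP=> e; rewrite !inE => /reads_before_trans; apply.
  by exists c; rewrite !inE ?reads_before_irr.
have pos_ltE c d : (pos c < pos d) = reads_before U c d.
  apply/idP/idP => [|/pos_lt //]; have [->|ne_cd] := eqVneq c d; first by rewrite ltnn.
  by case/orP: (reads_before_total U ne_cd) => // /pos_lt; case: ltngtP.
have pos_n c : pos c < n.
  rewrite -card_sh -cardsT; apply/proper_card/properP; split; first exact: subsetT.
  by exists c; rewrite !inE ?reads_before_irr.
pose T : {ffun cell sh -> 'I_n} := [ffun c => Ordinal (pos_n c)].
have TE c : T c = pos c :> nat by rewrite ffunE.
have T_inj : injective T.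
  move=> c d /(congr1 val); rewrite /= !TE => eq_pos; apply/eqP/negP => /negP ne_cd.
  by case/orP: (reads_before_total U ne_cd) => /pos_lt; rewrite eq_pos ltnn.
have T_bij : bijective T by apply: inj_card_bij T_inj _; rewrite card_ord card_sh.
have [g gK Kg] := T_bij.
have T_syt : T \in SYT n sh.
  rewrite inE; apply/and4P; split; first exact/injectiveP.
  - by apply/forallP=> i; apply/codomP; exists (g i); rewrite Kg.
  - apply/forallP=> c; apply/forallP=> d; have /forallP/(_ d) := U_row c.
    rewrite /= !TE pos_ltE /reads_before; lia.
  - apply/forallP=> c; apply/forallP=> d; have /forallP/(_ d) := U_col c.
    rewrite /= !TE pos_ltE /reads_before; lia.
(* The entries of [U] listed by increasing label form a sorted rearrangement of [s], hence [s]
   itself. *)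
have UE c : U c = nth 0 s (T c).
  suff -> : s = [seq U (g i) | i : 'I_n] by rewrite nth_mktuple gK.
  apply: (sorted_eq leq_trans anti_leq s_sorted); last first.
    rewrite perm_sym (perm_trans _ U_s) //.
    have -> : [seq U (g i) | i : 'I_n] = map U (map g (enum 'I_n)) by rewrite -map_comp.
    apply: perm_map; apply: uniq_perm; rewrite ?enum_uniq //.
      by rewrite map_inj_uniq ?enum_uniq //; apply: can_inj Kg.
    by move=> d; rewrite mem_enum; apply/mapP; exists (T d); rewrite ?mem_enum ?gK.
  apply/(sortedP 0) => i; rewrite size_map size_enum_ord => lt_i.
  have := nth_mktuple (fun i => U (g i)) 0 (Ordinal lt_i) => /= ->.
  have := nth_mktuple (fun i => U (g i)) 0 (Ordinal (ltnW lt_i)) => /= ->.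
  have : pos (g (Ordinal (ltnW lt_i))) < pos (g (Ordinal lt_i)) by rewrite -!TE !Kg /=.
  by rewrite pos_ltE /reads_before; lia.
(* At a descent the next cell is lower, so it cannot come later by tie-breaking: its entry is
   strictly larger. *)
exists T; rewrite // T_syt; apply/forall_inP => j; rewrite inE.
case/existsP=> c /existsP[d] /and3P[/eqP Tc /eqP Td lt_cd].
have : pos c < pos d by rewrite -!TE Tc Td /=.
rewrite pos_ltE /reads_before !UE Tc Td /=; lia.
Qed.

End Standardization.

(** * Coefficients of the fundamental and Schur functions *)

Local Open Scope ring_scope.

Lemma perm_seq_mset (m : {mset nat}%mset) (t : seq nat) :
  (seq_mset t == m) = perm_eq t (sort leq m).
Proof.
rewrite -[X in _ == X]seq_mset_id perm_sym perm_sort perm_sym.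
by apply/eqP/idP => /eq_seq_msetP.
Qed.

Lemma sum_monomials_eq0 (I : finType) (P : pred (I -> nat)) (m : {mset nat}%mset) :
  size m != #|I| -> sum_monomials P m = 0.
Proof.
move=> sz_m; rewrite /sum_monomials eq_card0 // => w; rewrite !inE.
apply/negP => /andP[_]; rewrite perm_seq_mset => /perm_size.
by rewrite size_sort size_map -cardE => eq_sz; rewrite eq_sz eqxx in sz_m.
Qed.

Section Coefficients.

Variables (n : nat) (m : {mset nat}%mset).
Hypothesis size_m : size m = n.

Let s := sort leq m.

Let s_sorted : sorted leq s.
Proof. exact/sort_sorted/leq_total. Qed.

Let size_s : size s = n.
Proof. by rewrite size_sort. Qed.

Lemma sorted_word : exists w : 'I_n -> finsupp m, forall i, val (w i) = nth 0%N s i.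
Proof.
suff /fin_all_exists[w wE] :
  forall i : 'I_n, exists x : finsupp m, val x = nth 0%N s i by exists w.
move=> i; have s_i : nth 0%N s i \in finsupp m.
  by rewrite multiset.msuppE -(mem_sort leq) mem_nth // size_s.
by exists [` s_i]%fset.
Qed.

Lemma prod_natb (J : finType) (A : {pred J}) (b : pred J) :
  \prod_(j in A) (b j)%:R = [forall j in A, b j]%:R :> int.
Proof.
have [/forall_inP b_A|] := boolP [forall j in A, b j].
  by rewrite big1 // => j /b_A ->.
rewrite negb_forall_in => /exists_inP[j jA /negbTE bj].
by rewrite (bigD1 j) //= bj mul0r.
Qed.

(** Only one weakly increasing word has monomial [m], so the counted set is empty or a singleton. *)
Lemma fundamental_coef (D : {set 'I_n.-1}) :
  fundamental D m = \prod_(j in D) (nth 0 s j < nth 0 s j.+1)%N%:R.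
Proof.
have [w0 w0E] := sorted_word.
rewrite prod_natb /fundamental /sum_monomials; set b := [forall j in D, _].
suff wE (w : {ffun 'I_n -> finsupp m}) : w \in [set w : {ffun 'I_n -> finsupp m} |
    ([forall j : 'I_n.-1, val (w (ord_here j)) <= val (w (ord_next j))]%N &&
     [forall j in D, val (w (ord_here j)) < val (w (ord_next j))]%N) &&
    (seq_mset [seq val (w i) | i : 'I_n] == m)] = b && (w == finfun w0).
  rewrite (eq_card wE); case: b {wE}; last by rewrite eq_card0.
  by congr (_ %:R); apply: card1.
rewrite inE perm_seq_mset; apply/idP/andP.
  move=> /andP[/andP[/forallP w_le /forall_inP w_lt] w_s].
  have w_nth i : val (w i) = nth 0%N s i.
    suff <- : [seq val (w i) | i : 'I_n] = s by rewrite nth_mktuple.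
    apply: (sorted_eq leq_trans anti_leq) w_s => //.
    apply/(sortedP 0%N) => j; rewrite size_map size_enum_ord => lt_j.
    have := nth_mktuple (fun i => val (w i)) 0%N (Ordinal lt_j) => /= ->.
    have := nth_mktuple (fun i => val (w i)) 0%N (Ordinal (ltnW lt_j)) => /= ->.
    have lt_j1 : (j < n.-1)%N by rewrite ltn_predRL.
    have := w_le (Ordinal lt_j1); congr (val (w _) <= val (w _))%N; exact: val_inj.
  split; first by apply/forall_inP => j /w_lt; rewrite !w_nth.
  by apply/eqP/ffunP => i; apply: val_inj; rewrite /= ffunE w_nth w0E.
case=> /forall_inP b_D /eqP ->.
have w_nth i : val (finfun w0 i) = nth 0%N s i by rewrite ffunE w0E.
rewrite -andbA; apply/and3P; split.
- apply/forallP => j; rewrite !w_nth; apply: (nth_sorted_le s_sorted size_s) => //=.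
  by rewrite -ltn_predRL.
- by apply/forall_inP => j jD; rewrite !w_nth b_D.
rewrite [X in perm_eq X _](_ : _ = s) ?perm_refl //.
apply: (@eq_from_nth _ 0%N); rewrite size_map size_enum_ord // => i lt_i.
by have := nth_mktuple (fun i => val (finfun w0 i)) 0%N (Ordinal lt_i);
  rewrite w_nth => /= ->.
Qed.

(** Replacing each label i by the i-th letter of [s] is a bijection from the standard tableaux whose
    descents are strict in [s] to the semistandard ones of content [m]. *)
Lemma schur_coef (sh : seq nat) : #|cell sh| = n ->
  schur sh m
  = \sum_(T in SYT n sh) \prod_(j in Des T) (nth 0 s j < nth 0 s j.+1)%N%:R.
Proof.
move=> card_sh; have [w0 w0E] := sorted_word.
under eq_bigr do rewrite prod_natb.
rewrite -natr_sum -big_mkcondr sum1_card /schur /sum_monomials; congr (_ %:R).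
pose lab (T : {ffun cell sh -> 'I_n}) : {ffun cell sh -> finsupp m} :=
  [ffun c => w0 (T c)].
have labE T c : val (lab T c) = nth 0%N s (T c) by rewrite ffunE w0E.
have lab_fun T : (fun c => val (lab T c)) = (fun c => nth 0%N s (T c)).
  by apply: funext.
rewrite -[RHS](card_in_imset (f := lab)
  (D := [pred T | (T \in SYT n sh) && strict_on_descents s T])) => [|T T']; last first.
  move=> /andP[T_syt T_des] /andP[T'_syt T'_des] eq_lab.
  apply: (standardization_inj card_sh s_sorted size_s) => // c.
  by rewrite -!labE eq_lab.
apply: eq_card => U; rewrite inE perm_seq_mset; apply/andP/imsetP => [[U_ss U_s]|].
  have [T T_syt TE] := standardization_exists card_sh s_sorted size_s U_ss U_s.
  by exists T => //; apply/ffunP=> c; apply: val_inj; rewrite /= labE TE.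
case=> T /andP[T_syt T_des] ->; rewrite lab_fun; split.
  exact: SYT_semistandard.
exact: SYT_content.
Qed.

End Coefficients.

Theorem theorem4p5 (n : nat) :
  (\sum_(P in PSet n) qmon (Desing P)
   = \sum_(0 <= k < n./2.+1)
       (\sum_(T in SYT n (two_row n k)) qmon (Des T)) *+ e_coef n k
     :> {mpoly int[n.-1]})
  /\
  (\sum_(P in PSet n) fundamental (Desing P)
   = \sum_(0 <= k < n./2.+1) schur (two_row n k) *+ e_coef n k
     :> series).
Proof.
split.
  pose q i : {mpoly int[n.-1]} := if insub i is Some j then 'X_j else 1.
  have qmonE (A : {set 'I_n.-1}) : qmon A = \prod_(j in A) q j.
    by apply: eq_bigr => j _; rewrite /q valK.
  under eq_bigr do rewrite qmonE; rewrite sum_PSet_SYT.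
  by apply: eq_bigr => k _; congr (_ *+ _); apply: eq_bigr => T _; rewrite qmonE.
apply: funext => m; rewrite !fct_sumE.
under [RHS]eq_bigr do rewrite natmulfctE.
(* Both sides are homogeneous of degree n, so other monomials have coefficient 0. *)
have [size_m|size_m] := eqVneq (size m) n; last first.
  rewrite big1 => [|P _]; last by rewrite /fundamental sum_monomials_eq0 ?card_ord.
  rewrite big_nat big1 // => k le_k.
  by rewrite /schur sum_monomials_eq0 ?mul0rn // card_two_row //; lia.
under [LHS]eq_bigr => P _ do rewrite (fundamental_coef size_m).
rewrite (sum_PSet_SYT (fun j => (nth 0 (sort leq m) j < nth 0 (sort leq m) j.+1)%N%:R)).
apply: eq_big_nat => k le_k; congr (_ *+ _).
by rewrite (schur_coef size_m) // card_two_row //; lia.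
Qed.
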